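(* Let $H$ be a hypergraph with $e$-index $k$, and let $\lambda_1(H)$ be the largest eigenvalue of its unified matrix $\mathbf{U}(H)$. Then $$\lambda_1(H)\geq \delta^*(H)-\frac{\partial(H)}{k}.$$
   Context: A hypergraph $H$ consists of a finite non-empty vertex set $V(H)$ and a multiset $E(H)$ of non-empty subsets of $V(H)$, called edges; $m(e)$ is the multiplicity of $e$ in $E(H)$. A 2-partition of a set $e$ is an unordered pair $\{S,S'\}$ of non-empty disjoint sets with $S\cup S'=e$; $S$ and $S'$ are called parts of $e$. $I(H)$ is the set of all parts of all edges of $H$ together with all singleton subsets of $V(H)$, and $k=|I(H)|$ is the $e$-index of $H$. The unified matrix $\mathbf{U}(H)$ is the $k\times k$ matrix indexed by $I(H)$ whose $(S,S')$ entry is: $m(S)$ if $S=S'$ is a singleton which is an edge of $H$; $m(e)$ if $\{S,S'\}$ is a 2-partition of an edge $e$ of $H$; and $0$ otherwise. For $S\in I(H)$, the unified degree $d_H(S)$ is the number of edges $e\in E(H)$ (counted with multiplicity) with $S\subseteq e$, and $\delta^*(H)=\min\{d_H(S): S\in I(H)\}$. An edge $e$ is included if there is an edge $e'\neq e$ of $H$ with $e\subset e'$. $\partial(H)$ is the number (counted with multiplicity) of included edges of $H$ of cardinality at least $2$. *)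

(* Defs.v *)
From mathcomp Require Import all_boot all_order all_algebra.
From mathcomp Require Import finmap multiset.

Set Implicit Arguments.
Unset Strict Implicit.
Unset Printing Implicit Defensive.

Import Order.TTheory GRing.Theory Num.Theory.

Local Open Scope mset_scope.
Local Open Scope nat_scope.

(* A multiset [E : {mset K}] applied to an element [e] gives the multiplicity
   of [e]; coerced to a sequence, it lists every element as many times as its
   multiplicity, so [count] and [size] count with multiplicity. *)
Record hypergraph := Hypergraph {
  vertex : finType;
  edges : {mset {set vertex}};
  vertex_nonempty : 0 < #|vertex|;
  edges_nonempty : set0 \notin edges }.

Definition two_partition (T : finType) (e S S' : {set T}) : bool :=
  [&& S != set0, S' != set0, [disjoint S & S'] & S :|: S' == e].

Section UnifiedMatrix.

Variable H : hypergraph.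
Implicit Types S e : {set vertex H}.

Definition is_part S : bool :=
  [exists e : {set vertex H}, (e \in edges H) &&
    [exists S' : {set vertex H}, two_partition e S S']].

Definition index_set : {set {set vertex H}} :=
  [set S | is_part S] :|: [set [set v] | v : vertex H].

Definition e_index : nat := #|index_set|.

(* In the second case [e] is unique, since it must be [S :|: S']. *)
Definition unified_entry S S' : nat :=
  if [&& S == S', #|S| == 1 & S \in edges H] then edges H S
  else if [pick e | (e \in edges H) && two_partition e S S'] is Some e
       then edges H e
       else 0.

Definition unified_matrix (R : nzRingType) : 'M[R]_e_index :=
  \matrix_(i, j) (unified_entry (enum_val i) (enum_val j))%:R%R.

Definition unified_degree S : nat := count (fun e => S \subset e) (edges H).

(* The default value, the number of edges, bounds all unified degrees and
   [index_set] is non-empty, so this is the minimum over [index_set]. *)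
Definition min_unified_degree : nat :=
  \big[minn/size (edges H)]_(S in index_set) unified_degree S.

(* Inclusion is between distinct subsets of the vertices: parallel copies of an
   edge do not make it included. *)
Definition included e : bool :=
  (e \in edges H) && [exists e' : {set vertex H}, (e' \in edges H) && (e \proper e')].

Definition num_included : nat :=
  count (fun e => included e && (2 <= #|e|)) (edges H).

End UnifiedMatrix.

Definition largest_eigenvalue (R : rcfType) (n : nat) (A : 'M[R]_n) (a : R) : Prop :=
  eigenvalue A a /\ forall b : R, eigenvalue A b -> (b <= a)%R.

(* Main.v *)
Require Import Defs.
From mathcomp Require Import all_boot all_order all_algebra.
From mathcomp Require Import finmap multiset complex.

Import GRing.Theory Num.Theory.
Local Open Scope ring_scope.

(** The unified matrix [U] is symmetric, so its largest eigenvalue bounds the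
    Rayleigh quotient of every vector ([symmetric_largest_eigenvalue]).  For the
    all-ones vector that quotient is the sum of all entries of [U] divided by
    [k], and it remains to evaluate row sums.

    In the row of [S], a non-zero entry off the diagonal sits at [e :\: S] for
    an edge [e] properly containing [S], and equals [m(e)]; the complement
    [e :\: S] is itself a part, so every such edge is seen exactly once.  The
    diagonal entry is [m(S)] when [S] is a singleton.  The row sum is therefore
    the unified degree [d(S)], which counts all edges containing [S], minus
    [m(S)] when [S] has at least two elements ([unified_row_sum]).  In that
    last case [S] is in the index set only as a part of a larger edge, so if it
    is an edge it is an included one; the total loss is thus at most
    [num_included] ([index_edges_le_included]).  Summing over the index set, the
    entries of [U] add up to at least [k * delta - num_included].

    The existence of the largest eigenvalue comes from the spectral theorem over
    the algebraic closure [R[i]] of the real closed field [R]. *)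

(** * The largest eigenvalue of a symmetric matrix *)

Section LargestEigenvalue.
Set Implicit Arguments.
Unset Strict Implicit.
Local Open Scope sesquilinear_scope.

(** With [A = P^t* D P] and [w = v P^t*], the two sides are the sums of
    [d_i |w_i|^2] and of [c |w_i|^2]. *)
Lemma hermitian_rayleigh_le (C : numClosedFieldType) (n : nat) (A : 'M[C]_n)
    (c : C) :
    A \is hermsymmx -> (forall i, spectral_diag A 0 i <= c) ->
  forall v : 'rV[C]_n, (v *m A *m v^t*) 0 0 <= c * (v *m v^t*) 0 0.
Proof.
move=> hA hc v.
have hU := spectral_unitarymx A.
have /orthomx_spectralP := hermitian_normalmx hA.
rewrite invmx_unitary //; move: (spectralmx A) (spectral_diag A) hU hc.
move=> P d hU hc ->; have [w wE] : {w | v *m P^t* = w} by exists (v *m P^t*).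
have wtE : P *m v^t* = w^t* by rewrite -wE trmx_mul map_mxM trmxCK.
have -> : v *m v^t* = w *m w^t*.
  by rewrite -wtE -wE mulmxA -(mulmxA v) -(invmx_unitary hU) mulVmx
             ?unitarymx_unit // mulmx1.
rewrite !mulmxA wE -mulmxA wtE !mxE mulr_sumr; apply: ler_sum => i _.
rewrite mul_mx_diag !mxE [w 0 i * _]mulrC -mulrA.
by rewrite ler_wpM2r // mul_conjC_ge0.
Qed.

(** The eigenvectors are the rows of the diagonalizing unitary matrix. *)
Lemma spectral_diag_eigenvalue (C : numClosedFieldType) (n : nat)
    (A : 'M[C]_n) (i : 'I_n) :
  A \is normalmx -> eigenvalue A (spectral_diag A 0 i).
Proof.
move=> /orthomx_spectralP AE; set P := spectralmx A in AE.
have hP : P \in unitmx by exact: spectral_unit.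
apply/eigenvalueP; exists (row i P).
  rewrite {1}AE !mulmxA rowE mulmxK //.
  by rewrite -(rowE i (diag_mx _)) row_diag_mx -scalemxAl.
apply/eqP; rewrite rowE => /(congr1 (mulmx^~ (invmx P))).
rewrite mulmxK // mul0mx => /matrixP/(_ 0 i)/eqP.
by rewrite !mxE !eqxx oner_eq0.
Qed.

(** The witness is the largest diagonal entry of the diagonalization over
    [R[i]].  These entries are real, and an eigenvalue in [R] of a matrix
    extended to [R[i]] is already one over [R].  The Rayleigh bound, applied to
    eigenvectors, shows that no eigenvalue is larger. *)
Lemma symmetric_largest_eigenvalue (R : rcfType) (n : nat) (A : 'M[R]_n) :
    (0 < n)%N -> A^T = A ->
  exists2 a : R, largest_eigenvalue A a &
    forall v : 'rV[R]_n, (v *m A *m v^T) 0 0 <= a * (v *m v^T) 0 0.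
Proof.
move=> n_gt0 symA; pose toC := real_complex R; pose B := map_mx toC A.
have conj_toC x : (toC x)^* = toC x by exact: conjc_real.
have hB : B \is hermsymmx.
  apply/is_hermitianmxP/matrixP => i j.
  by rewrite expr0 scale1r !mxE conj_toC -{1}symA mxE.
pose d i := complex.Re (spectral_diag B 0 i).
have dR i : toC (d i) = spectral_diag B 0 i.
  by apply/RRe_real/mxOverP/hermitian_spectral_diag_real.
pose i0 := [arg max_(i > Ordinal n_gt0) d i]%O.
have max_i0 i : d i <= d i0.
  by rewrite /i0; case: Order.TotalTheory.arg_maxP => // k _; apply.
have rayleigh (v : 'rV[R]_n) : (v *m A *m v^T) 0 0 <= d i0 * (v *m v^T) 0 0.
  have := @hermitian_rayleigh_le _ _ B (toC (d i0)) hB _ (map_mx toC v).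
  have -> : (map_mx toC v)^t* = map_mx toC v^T.
    by apply/matrixP=> i j; rewrite !mxE conj_toC.
  rewrite -!map_mxM !mxE -rmorphM lecR; apply=> i.
  by rewrite -dR lecR max_i0.
exists (d i0) => //; split=> [|b].
  have : eigenvalue B (toC (d i0)).
    by rewrite dR; exact/spectral_diag_eigenvalue/hermitian_normalmx.
  by rewrite eigenvalue_map.
case/eigenvalueP=> v vA vn0; have := rayleigh v.
rewrite vA -scalemxAl mxE ler_pM2r // mxE.
have sq_ge0 i : true -> 0 <= v 0 i * v^T i 0.
  by move=> _; rewrite !mxE -expr2 sqr_ge0.
rewrite lt0r sumr_ge0 // andbT psumr_eq0 //.
apply: contraNN vn0 => /allP v0; apply/eqP/rowP=> i; apply/eqP.
by have := v0 i (mem_index_enum i); rewrite !mxE -expr2 sqrf_eq0.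
Qed.

End LargestEigenvalue.

(** * Row sums of the unified matrix *)

Section RowSums.
Set Implicit Arguments.
Unset Strict Implicit.
Local Open Scope nat_scope.

Lemma count_sum_mult (T : finType) (P : pred T) (s : seq T) :
  count P s = \sum_(x | P x) count_mem x s.
Proof.
elim: s => [|y s IH] /=; first by rewrite big1.
rewrite big_split -IH /=; congr (_ + _).
have [Py|nPy] := boolP (P y); last first.
  by rewrite big1 // => x Px; case: eqP Px nPy => // -> ->.
rewrite (bigD1 y) //= eqxx big1 // => x /andP[_ /negPf].
by rewrite eq_sym => ->.
Qed.

Lemma bigmin_le_nat (T : eqType) (s : seq T) (P : pred T) (F : T -> nat) n x :
  x \in s -> P x -> \big[minn/n]_(i <- s | P i) F i <= F x.
Proof.
elim: s => // y s IH; rewrite inE big_cons => /predU1P [<- -> | xs Px].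
  exact: geq_minl.
by case: (P y); rewrite ?geq_min IH ?orbT.
Qed.

Lemma two_partitionC (T : finType) (e S S' : {set T}) :
  two_partition e S S' = two_partition e S' S.
Proof. by rewrite /two_partition setUC disjoint_sym andbCA. Qed.

Variable H : hypergraph.
Implicit Types S e : {set vertex H}.

Lemma count_edges (P : pred {set vertex H}) :
  count P (edges H) = \sum_(e | P e) edges H e.
Proof.
by rewrite count_sum_mult; apply: eq_bigr => e _; rewrite count_mem_mset.
Qed.

Lemma nonedge_mult e : e \notin edges H -> edges H e = 0.
Proof. exact: mset_eq0P. Qed.

(** The two cases of an entry exclude each other, because a set is never
    disjoint from itself unless it is empty; so the entry is a sum, in which
    the choice of an edge has become the only possible one, [S :|: S']. *)
Lemma unified_entryE S S' :
  unified_entry S S' = (if (S == S') && (#|S| == 1) then edges H S else 0) +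
    (if two_partition (S :|: S') S S' then edges H (S :|: S') else 0).
Proof.
rewrite /unified_entry /two_partition eqxx andbT.
have [->|nSS'] := eqVneq S S'.
  have -> : [&& S' != set0, S' != set0 & [disjoint S' & S']] = false.
    by rewrite -setI_eq0 setIid; case: eqP.
  case: pickP => [e /andP[_]|_].
    rewrite /two_partition -setI_eq0 setIid.
    by case: (S' == set0).
  rewrite addn0 andTb; case: (#|S'| == 1) => //=.
  by case: ifPn => // /nonedge_mult.
rewrite add0n /=; case: pickP => [e /and5P[eE -> -> -> /eqP ->] // | none].
case: ifPn => // part; apply/esym/nonedge_mult/negP => eE.
by have := none (S :|: S'); rewrite eE /two_partition eqxx andbT part.
Qed.

Lemma unified_entryC S S' : unified_entry S S' = unified_entry S' S.
Proof.
rewrite !unified_entryE; congr (_ + _).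
  by rewrite eq_sym; case: eqVneq => //= ->.
by rewrite setUC two_partitionC.
Qed.

Lemma part_index e S S' :
  e \in edges H -> two_partition e S S' -> S \in index_set H.
Proof.
move=> eE part; rewrite inE; apply/orP; left; rewrite inE.
by apply/existsP; exists e; rewrite eE; apply/existsP; exists S'.
Qed.

Lemma index_set_neq0 S : S \in index_set H -> S != set0.
Proof.
rewrite !inE => /orP[/existsP[e /andP[_ /existsP[S' /and4P[]]]] //|].
by case/imsetP=> v _ ->; rewrite -card_gt0 cards1.
Qed.

(** The map [S' |-> S :|: S'], with inverse [e |-> e :\: S], matches the
    2-partitions having [S] as a part with the proper supersets of [S]. *)
Lemma unified_row_sum S : S \in index_set H ->
  \sum_(S' in index_set H) unified_entry S S' + (2 <= #|S|) * edges H S =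
    unified_degree S.
Proof.
move=> SI; have S0 := index_set_neq0 SI.
have self : \sum_(S' in index_set H)
    (if (S == S') && (#|S| == 1) then edges H S else 0) =
    (#|S| == 1) * edges H S.
  rewrite (bigD1 S) //= eqxx big1 ?addn0 => [|S' /andP[_ /negPf]].
    by case: (#|S| == 1); rewrite ?mul1n.
  by rewrite eq_sym => ->.
have proper_ext : \sum_(S' in index_set H)
    (if two_partition (S :|: S') S S' then edges H (S :|: S') else 0) =
    \sum_(e : {set vertex H} | (S \subset e) && (e != S)) edges H e.
  rewrite [RHS](reindex_onto (fun S' => S :|: S') (fun e => e :\: S)) /=;
    last first.
    by move=> e /andP[Se _]; rewrite -{1}(setIidPr Se) setID.
  rewrite big_mkcond [RHS]big_mkcond; apply: eq_bigr => S' _ /=.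
  have -> : [&& (S \subset S :|: S') && (S :|: S' != S)
      & (S :|: S') :\: S == S'] = two_partition (S :|: S') S S'.
    rewrite /two_partition subsetUl S0 eqxx andbT /= setDUl setDv set0U.
    rewrite disjoint_sym (sameP eqP setDidPl) andbC [RHS]andbC.
    have [dis|//] := boolP [disjoint S' & S]; congr (~~ _).
    apply/eqP/eqP => [SS'|->]; last by rewrite setU0.
    rewrite -setI_eq0 in dis; rewrite -(eqP dis).
    by apply/esym/setIidPl; rewrite -SS' subsetUr.
  (* Outside the index set, [S'] cannot complete [S] to an edge, so the
     multiplicity of [S :|: S'] is zero there. *)
  case: ifP => // S'I; case: ifPn => // part; apply/esym/nonedge_mult.
  apply: contraFN S'I => eE; apply: (part_index (S' := S) eE).
  by rewrite two_partitionC.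
under eq_bigr => S' _ do rewrite unified_entryE.
rewrite big_split /= self proper_ext /unified_degree count_edges.
rewrite [RHS](bigD1 S) //= addnAC -mulnDl; congr (_ + _).
by rewrite -card_gt0 in S0; case: #|S| S0 => [|[|n]]; rewrite // mul1n.
Qed.

(** A set of the index set that is not a singleton is a part, hence properly
    contained in an edge. *)
Lemma included_part S :
  S \in index_set H -> S \in edges H -> 2 <= #|S| -> included S.
Proof.
rewrite /included => SI -> S2 /=; move: SI; rewrite !inE => /orP[|].
  case/existsP=> e /andP[eE /existsP[S' /and4P[S0 S'0 dis /eqP eS]]].
  apply/existsP; exists e; rewrite eE -eS properEneq subsetUl andbT eq_sym.
  apply: contra S'0 => /eqP SS'.
  by rewrite -(setIidPr (subsetUr S S')) SS' setI_eq0.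
by case/imsetP=> v _ Sv; rewrite Sv cards1 in S2.
Qed.

Lemma index_edges_le_included :
  \sum_(S in index_set H) (2 <= #|S|) * edges H S <= num_included H.
Proof.
rewrite /num_included count_edges big_mkcond [leqRHS]big_mkcond /=.
apply: leq_sum => S _; case: ifP => // SI.
have [S2|] := boolP (2 <= #|S|); last by rewrite mul0n.
have [SE|/nonedge_mult->] := boolP (S \in edges H); last by rewrite muln0.
by rewrite included_part // mul1n.
Qed.

Lemma min_degree_sum_le :
  min_unified_degree H * e_index H <=
    \sum_(S in index_set H) \sum_(S' in index_set H) unified_entry S S' +
      num_included H.
Proof.
apply: leq_trans (leq_add (leqnn _) index_edges_le_included).
rewrite -big_split /= mulnC -sum_nat_const; apply: leq_sum => S SI.
by rewrite unified_row_sum // bigmin_le_nat // mem_index_enum.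
Qed.

Lemma e_index_gt0 : 0 < e_index H.
Proof.
have /card_gt0P[v _] := vertex_nonempty H.
apply/card_gt0P; exists [set v]; rewrite inE; apply/orP; right.
exact: imset_f.
Qed.

End RowSums.

(** * The bound *)

(** The Rayleigh bound at the all-ones vector [u], multiplied through by
    [u u^T = k]. *)
Theorem theorem9p3 (R : rcfType) (H : hypergraph) :
  exists lambda1 : R,
    largest_eigenvalue (unified_matrix H R) lambda1 /\
    lambda1 >= (min_unified_degree H)%:R - (num_included H)%:R / (e_index H)%:R.
Proof.
have symU : (unified_matrix H R)^T = unified_matrix H R.
  by apply/matrixP=> i j; rewrite !mxE unified_entryC.
have [a a_max rayleigh] := symmetric_largest_eigenvalue (e_index_gt0 H) symU.
exists a; split=> //.
have k_gt0 : 0 < (e_index H)%:R :> R by rewrite ltr0n e_index_gt0.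
rewrite lerBlDr -(ler_pM2r k_gt0) mulrDl mulfVK ?lt0r_neq0 //.
pose u : 'rV[R]_(e_index H) := const_mx 1.
have uu : (u *m u^T) 0 0 = (e_index H)%:R.
  rewrite mxE (eq_bigr (fun=> 1)) => [|i _]; last by rewrite !mxE mulr1.
  by rewrite sumr_const card_ord.
have uUu : (u *m unified_matrix H R *m u^T) 0 0 =
    (\sum_(S in index_set H) \sum_(S' in index_set H) unified_entry S S')%:R.
  rewrite exchange_big mxE natr_sum [RHS]big_enum_val /=.
  apply: eq_bigr => j _; rewrite !mxE mulr1 natr_sum [RHS]big_enum_val /=.
  by apply: eq_bigr => i _; rewrite !mxE mul1r.
apply: (@Order.POrderTheory.le_trans _ _
  ((u *m unified_matrix H R *m u^T) 0 0 + (num_included H)%:R)).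
  by rewrite uUu -natrD -natrM ler_nat min_degree_sum_le.
by rewrite lerD2r -uu rayleigh.
Qed.
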